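(* Let $T$ be an h-inductive theory in a first-order language $L$. Then $T$ is a locally positive Robinson (lpR) theory if and only if for every pc model $A$ of $T$, every positive formula $\varphi(\bar x)$ and every tuple $\bar a$ of $A$ with $A\not\models\varphi(\bar a)$, there exists a quantifier-free positive formula $\psi(\bar x)$ such that $A\models\psi(\bar a)$ and $T_k^\star(A)\vdash\neg\exists\bar x\,(\varphi(\bar x)\wedge\psi(\bar x))$.
   Context: Positive logic. A positive formula is one built from atomic formulas using $\wedge$, $\vee$ and $\exists$. An h-inductive sentence is a finite conjunction of sentences $\forall\bar x\,(\exists\bar y\,\psi(\bar x,\bar y)\rightarrow\exists\bar z\,\varphi(\bar x,\bar z))$ with $\psi,\varphi$ quantifier-free positive; an h-inductive theory is a set of such sentences. A homomorphism of $L$-structures preserves atomic formulas; it is an immersion if it preserves and reflects all positive formulas. A model $A$ of $T$ is positively closed (pc) if every homomorphism from $A$ into a model of $T$ is an immersion. For a tuple $\bar a$ of $A$, $tp(\bar a)$ (resp. $tpqf(\bar a)$) is the set of positive (resp. quantifier-free positive) formulas satisfied by $\bar a$ in $A$. $T$ is an lpR theory if for every pc model $A$ of $T$ and all tuples $\bar a,\bar b$ of $A$, $tpqf(\bar a)\subseteq tpqf(\bar b)$ implies $tp(\bar a)=tp(\bar b)$. $T_k^\star(A)$ is the set of h-inductive $L$-sentences (without parameters) true in $A$. *)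

(* Defs.v *)
From mathcomp Require Import all_boot.
From mathcomp Require Import boolp classical_sets.

Set Implicit Arguments.
Unset Strict Implicit.
Unset Printing Implicit Defensive.

Local Open Scope classical_set_scope.

Record language := Language {
  fsym : Type;
  rsym : Type;
  farity : fsym -> nat;
  rarity : rsym -> nat }.

(* Terms and formulas are well-scoped: in [term L n] and [formula L n] the
   free variables are indexed by 'I_n, and an n-tuple of elements of a
   structure A is a function 'I_n -> A. *)
Inductive term (L : language) (n : nat) : Type :=
| Var (i : 'I_n)
| App (f : fsym L) (args : 'I_(farity f) -> term L n).

Inductive formula (L : language) : nat -> Type :=
| FTop n : formula L n
| FBot n : formula L n
| FEq n (t u : term L n) : formula L n
| FRel n (r : rsym L) (args : 'I_(rarity r) -> term L n) : formula L n
| FAnd n (p q : formula L n) : formula L n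
| FOr n (p q : formula L n) : formula L n
| FImp n (p q : formula L n) : formula L n
| FEx n (p : formula L n.+1) : formula L n
| FAll n (p : formula L n.+1) : formula L n.

Arguments FTop {L n}.
Arguments FBot {L n}.

Definition FNot L n (p : formula L n) : formula L n := FImp p FBot.

Definition sentence (L : language) := formula L 0.

Definition atomic L n (p : formula L n) : bool :=
  match p with
  | FEq _ _ _ | FRel _ _ _ => true
  | _ => false
  end.

Fixpoint quantifier_free L n (p : formula L n) : bool :=
  match p with
  | FTop _ | FBot _ | FEq _ _ _ | FRel _ _ _ => true
  | FAnd _ q r | FOr _ q r | FImp _ q r =>
      quantifier_free q && quantifier_free r
  | FEx _ _ | FAll _ _ => false
  end.

(* As usual in positive logic, the empty conjunction FTop and the empty
   disjunction FBot count as quantifier-free positive formulas; thus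
   h-inductive sentences include the negations of positive sentences. *)
Fixpoint positive L n (p : formula L n) : bool :=
  match p with
  | FTop _ | FBot _ | FEq _ _ _ | FRel _ _ _ => true
  | FAnd _ q r | FOr _ q r => positive q && positive r
  | FEx _ q => positive q
  | FImp _ _ _ | FAll _ _ => false
  end.

Definition qf_positive L n (p : formula L n) : bool :=
  quantifier_free p && positive p.

(* FEx and FAll bind the variable ord0 of their body, so in a formula with
   k + n variables the first k are the ones bound by [ex_block k n]. *)
Fixpoint ex_block L (k n : nat) : formula L (k + n) -> formula L n :=
  match k with
  | 0 => fun p => p
  | k'.+1 => fun p => @ex_block L k' n (FEx p)
  end.

Fixpoint ex_closure L (n : nat) : formula L n -> sentence L :=
  match n with
  | 0 => fun p => p
  | n'.+1 => fun p => @ex_closure L n' (FEx p)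
  end.

Fixpoint all_closure L (n : nat) : formula L n -> sentence L :=
  match n with
  | 0 => fun p => p
  | n'.+1 => fun p => @all_closure L n' (FAll p)
  end.

Inductive h_inductive L : sentence L -> Prop :=
| h_inductive_basic n k l (psi : formula L (k + n)) (phi : formula L (l + n)) :
    qf_positive psi -> qf_positive phi ->
    h_inductive (all_closure (FImp (ex_block psi) (ex_block phi)))
| h_inductive_and s t :
    h_inductive s -> h_inductive t -> h_inductive (FAnd s t).

Definition h_inductive_theory L (T : set (sentence L)) : Prop :=
  T `<=` @h_inductive L.

Record structure (L : language) := Structure {
  carrier :> Type;
  carrier_inhabited : inhabited carrier;
  finterp : forall f : fsym L, ('I_(farity f) -> carrier) -> carrier;
  rinterp : forall r : rsym L, ('I_(rarity r) -> carrier) -> Prop }.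

Definition vempty (A : Type) (i : 'I_0) : A :=
  let: Ordinal _ h := i in match notF h with end.

Definition vcons (A : Type) n (x : A) (v : 'I_n -> A) (i : 'I_n.+1) : A :=
  if unlift ord0 i is Some j then v j else x.

Fixpoint eval L (A : structure L) n (v : 'I_n -> A) (t : term L n) : A :=
  match t with
  | Var i => v i
  | App f args => finterp (fun i => eval v (args i))
  end.

Fixpoint sat L (A : structure L) n (p : formula L n) : ('I_n -> A) -> Prop :=
  match p in formula _ m return ('I_m -> A) -> Prop with
  | FTop _ => fun _ => True
  | FBot _ => fun _ => False
  | FEq _ t u => fun v => eval v t = eval v u
  | FRel _ r args => fun v => rinterp (fun i => eval v (args i))
  | FAnd _ q r => fun v => sat q v /\ sat r v
  | FOr _ q r => fun v => sat q v \/ sat r v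
  | FImp _ q r => fun v => sat q v -> sat r v
  | FEx _ q => fun v => exists x : A, sat q (vcons x v)
  | FAll _ q => fun v => forall x : A, sat q (vcons x v)
  end.

Definition holds L (A : structure L) (s : sentence L) : Prop :=
  sat s (@vempty A).

Definition model L (T : set (sentence L)) (A : structure L) : Prop :=
  forall s, T s -> holds A s.

Definition entails L (T : set (sentence L)) (s : sentence L) : Prop :=
  forall A : structure L, model T A -> holds A s.

Definition homomorphism L (A B : structure L) (f : A -> B) : Prop :=
  forall n (p : formula L n), atomic p ->
  forall a : 'I_n -> A, sat p a -> sat p (f \o a).

Definition immersion L (A B : structure L) (f : A -> B) : Prop :=
  forall n (p : formula L n), positive p ->
  forall a : 'I_n -> A, sat p a <-> sat p (f \o a).

Definition pc_model L (T : set (sentence L)) (A : structure L) : Prop :=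
  model T A /\
  forall (B : structure L) (f : A -> B),
    model T B -> homomorphism f -> immersion f.

Definition tp L (A : structure L) n (a : 'I_n -> A) : set (formula L n) :=
  [set p | positive p /\ sat p a].

Definition tpqf L (A : structure L) n (a : 'I_n -> A) : set (formula L n) :=
  [set p | qf_positive p /\ sat p a].

Definition lpR L (T : set (sentence L)) : Prop :=
  forall A : structure L, pc_model T A ->
  forall n (a b : 'I_n -> A), tpqf a `<=` tpqf b -> tp a = tp b.

Definition Tkstar L (A : structure L) : set (sentence L) :=
  [set s | h_inductive s /\ holds A s].

(* Main.v *)
(* An instance of [T_k^*(A) |- ~ exists x, (phi /\ psi)] just says that
   [phi /\ psi] has no solution in A, its negation being h-inductive once phi
   is put in prenex form.

   If T is lpR and every psi in tpqf(a) is compatible with phi in A, then an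
   ultrapower of A contains b with phi(b) and tpqf(a) included in tpqf(b).
   Continue the ultrapower into a pc model C: the map from A to C is an
   immersion, so lpR gives tp(a) = tp(b) in C, whence phi(a).

   Conversely the criterion gives tp(b) included in tp(a) as soon as tpqf(a)
   is included in tpqf(b), and positive types of tuples in a pc model are
   maximal: if tp(b) is included in tp(a), some homomorphism from A into an
   ultrapower of A sends b to the diagonal image of a.

   For the pc continuation, interpret iterated Henkin constants in models of T
   and choose by Zorn's lemma an interpretation with a maximal positive
   diagram (chains are bounded by ultraproducts); the interpreted constants
   then form the required pc model. *)
Require Import Defs.
From mathcomp Require Import all_boot.
From mathcomp Require Import boolp classical_sets filter.

Set Implicit Arguments.
Unset Strict Implicit.
Unset Printing Implicit Defensive.

Local Open Scope classical_set_scope.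

(** * Tuples, renaming and prenex form *)

(** The block comes first because [ex_block] binds the first [k] of the [k + n] variables. *)
Definition vapp (A : Type) k n (w : 'I_k -> A) (v : 'I_n -> A) (i : 'I_(k + n)) : A :=
  match split i with inl j => w j | inr j => v j end.

Lemma vapp_lshift (A : Type) k n (w : 'I_k -> A) (v : 'I_n -> A) :
  vapp w v \o lshift n = w.
Proof. by apply/funext => i; rewrite /vapp /= (unsplitK (inl i)). Qed.

Lemma vapp_rshift (A : Type) k n (w : 'I_k -> A) (v : 'I_n -> A) :
  vapp w v \o @rshift k n = v.
Proof. by apply/funext => i; rewrite /vapp /= (unsplitK (inr i)). Qed.

Lemma vapp0 (A : Type) n (w : 'I_0 -> A) (v : 'I_n -> A) : vapp w v = v.
Proof.
rewrite -[RHS](vapp_rshift w v); apply/funext => i /=.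
by congr (vapp _ _ _); apply: val_inj.
Qed.

Lemma comp_vapp (A B : Type) (f : A -> B) k n (w : 'I_k -> A) (v : 'I_n -> A) :
  f \o vapp w v = vapp (f \o w) (f \o v).
Proof. by apply/funext => i; rewrite /vapp /=; case: split. Qed.

Lemma vapp_eta (A : Type) k n (u : 'I_(k + n) -> A) :
  vapp (u \o lshift n) (u \o @rshift k n) = u.
Proof.
apply/funext => i; rewrite /vapp -[in RHS](splitK i) /=.
by case: (split i).
Qed.

Lemma vcons0 (A : Type) n (x : A) (v : 'I_n -> A) : vcons x v ord0 = x.
Proof. by rewrite /vcons unlift_none. Qed.

Lemma vcons_lift (A : Type) n (x : A) (v : 'I_n -> A) : vcons x v \o lift ord0 = v.
Proof. by apply/funext => i; rewrite /vcons /= liftK. Qed.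

Lemma comp_vcons (A B : Type) (f : A -> B) n (x : A) (v : 'I_n -> A) :
  f \o vcons x v = vcons (f x) (f \o v).
Proof. by apply/funext => i; rewrite /vcons /=; case: unlift. Qed.

Lemma vcons_eta (A : Type) n (u : 'I_n.+1 -> A) :
  vcons (u ord0) (u \o lift ord0) = u.
Proof. by apply/funext => i; rewrite /vcons; case: unliftP => [j|] ->. Qed.

(** [k.+1 + n] and [(k + n).+1] are convertible, and the ordinals to be compared differ only in
    their bound proofs, hence [val_inj]. *)
Lemma vcons_vapp (A : Type) k n (x : A) (w : 'I_k -> A) (v : 'I_n -> A) :
  vcons x (vapp w v) = vapp (vcons x w) v :> ('I_(k.+1 + n) -> A).
Proof.
rewrite -[LHS](@vapp_eta A k.+1 n); congr vapp.
  rewrite -[LHS]vcons_eta; congr vcons.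
    by rewrite -[RHS](vcons0 x (vapp w v)) /=; congr (vcons _ _ _); apply: val_inj.
  rewrite -[RHS](vapp_lshift w v) -[X in _ = X \o _](vcons_lift x (vapp w v)).
  by apply/funext => i /=; congr (vcons _ _ _); apply: val_inj.
rewrite -[RHS](vapp_rshift w v) -[X in _ = X \o _](vcons_lift x (vapp w v)).
by apply/funext => i /=; congr (vcons _ _ _); apply: val_inj.
Qed.

Lemma vempty_eq (A : Type) (v : 'I_0 -> A) : v = @vempty A.
Proof. by apply/funext => -[]. Qed.

Section Syntax.
Variable L : language.

Lemma sat_ex_block (A : structure L) k n (p : formula L (k + n)) (v : 'I_n -> A) :
  sat (ex_block p) v <-> exists w : 'I_k -> A, sat p (vapp w v).
Proof.
elim: k p => [|k IH] p /=.
  by split=> [h|[w]]; [exists (@vempty A)|]; rewrite vapp0.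
rewrite IH /=; split=> [[w [x h]]|[w h]].
  by exists (vcons x w); rewrite -vcons_vapp.
by exists (w \o lift ord0), (w ord0); rewrite vcons_vapp vcons_eta.
Qed.

Lemma positive_ex_block k n (p : formula L (k + n)) :
  positive p -> positive (ex_block p).
Proof. by elim: k p => [|k IH] p //= hp; apply: IH. Qed.

Lemma holds_all_closure (A : structure L) n (p : formula L n) :
  holds A (all_closure p) <-> forall v : 'I_n -> A, sat p v.
Proof.
elim: n p => [|n IH] p /=.
  by split=> [h v|]; [rewrite (vempty_eq v) | apply].
rewrite IH /=; split=> [h v|h v x]; last exact: h.
by rewrite -(vcons_eta v).
Qed.

Lemma holds_ex_closure (A : structure L) n (p : formula L n) :
  holds A (ex_closure p) <-> exists v : 'I_n -> A, sat p v.
Proof.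
elim: n p => [|n IH] p /=.
  by split=> [h|[v]]; [exists (@vempty A) | rewrite (vempty_eq v)].
rewrite IH /=; split=> [[v [x h]]|[v h]]; first by exists (vcons x v).
by exists (v \o lift ord0), (v ord0); rewrite vcons_eta.
Qed.

Fixpoint tren n m (r : 'I_n -> 'I_m) (t : term L n) : term L m :=
  match t with
  | Var i => Var L (r i)
  | App f args => App (fun i => tren r (args i))
  end.

Fixpoint fren n (p : formula L n) : forall m, ('I_n -> 'I_m) -> formula L m :=
  match p in formula _ n return forall m, ('I_n -> 'I_m) -> formula L m with
  | FTop _ => fun m r => FTop
  | FBot _ => fun m r => FBot
  | FEq _ t u => fun m r => FEq (tren r t) (tren r u)
  | FRel _ s args => fun m r => FRel (fun i => tren r (args i))
  | FAnd _ q q' => fun m r => FAnd (fren q r) (fren q' r)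
  | FOr _ q q' => fun m r => FOr (fren q r) (fren q' r)
  | FImp _ q q' => fun m r => FImp (fren q r) (fren q' r)
  | FEx _ q => fun m r => FEx (fren q (vcons ord0 (lift ord0 \o r)))
  | FAll _ q => fun m r => FAll (fren q (vcons ord0 (lift ord0 \o r)))
  end.

Lemma eval_tren (A : structure L) n m (r : 'I_n -> 'I_m) (t : term L n) (v : 'I_m -> A) :
  eval v (tren r t) = eval (v \o r) t.
Proof. by elim: t => //= f args IH; congr finterp; apply/funext => i; apply: IH. Qed.

Lemma sat_fren (A : structure L) n (p : formula L n) m (r : 'I_n -> 'I_m) (v : 'I_m -> A) :
  sat (fren p r) v <-> sat p (v \o r).
Proof.
have E k l (r' : 'I_k -> 'I_l) (x : A) (u : 'I_l -> A) :
    vcons x u \o vcons ord0 (lift ord0 \o r') = vcons x (u \o r').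
  by rewrite comp_vcons vcons0 compA vcons_lift.
elim: n / p m r v => //=.
- by move=> n t u m r v; rewrite !eval_tren.
- move=> n s args m r v.
  by under eq_fun do rewrite eval_tren.
- by move=> n p IHp q IHq m r v; rewrite IHp IHq.
- by move=> n p IHp q IHq m r v; rewrite IHp IHq.
- by move=> n p IHp q IHq m r v; rewrite IHp IHq.
- by move=> n p IH m r v; split=> -[x h]; exists x; move: h; rewrite IH E.
- by move=> n p IH m r v; split=> h x; move: (h x); rewrite IH E.
Qed.

Lemma positive_fren n (p : formula L n) m (r : 'I_n -> 'I_m) :
  positive (fren p r) = positive p.
Proof. by elim: n / p m r => //= n p IHp q IHq m r; rewrite IHp IHq. Qed.

Lemma qf_positive_fren n (p : formula L n) m (r : 'I_n -> 'I_m) :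
  qf_positive (fren p r) = qf_positive p.
Proof.
rewrite /qf_positive positive_fren; congr andb.
by elim: n / p m r => //= n p IHp q IHq m r; rewrite IHp IHq.
Qed.

Lemma finite_conj n (I : finType) (F : I -> formula L n) :
  (forall i, positive (F i)) ->
  exists q : formula L n, positive q /\
    forall (A : structure L) (v : 'I_n -> A), sat q v <-> forall i, sat (F i) v.
Proof.
move=> hF.
have [q [qp qs]] : exists q : formula L n, positive q /\
    forall (A : structure L) (v : 'I_n -> A), sat q v <-> {in enum I, forall i, sat (F i) v}.
  elim: (enum I) => [|i s [q [qp qs]]]; first by exists FTop.
  exists (FAnd (F i) q); split=> [|A v /=]; first by rewrite /= hF.
  rewrite qs; split=> [[h1 h2] j|h].
    by rewrite inE => /predU1P[->|/h2].
  by split=> [|j hj]; apply: h; rewrite inE ?eqxx ?hj ?orbT.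
exists q; split=> // A v; rewrite qs; split=> h i; last by move=> _; apply: h.
by apply: h; rewrite mem_enum.
Qed.

(** Serves to build h-inductive sentences, which admit only existential blocks over quantifier-free
    formulas. The prenex form is chosen before the structure, so one form serves all of them. *)
Lemma positive_prenex n (p : formula L n) : positive p ->
  exists k (q : formula L (k + n)), qf_positive q /\
    forall (A : structure L) (v : 'I_n -> A),
      sat p v <-> exists w : 'I_k -> A, sat q (vapp w v).
Proof.
have qf m (p' : formula L m) : qf_positive p' -> exists k (q : formula L (k + m)), qf_positive q /\
    forall (A : structure L) (v : 'I_m -> A),
      sat p' v <-> exists w : 'I_k -> A, sat q (vapp w v).
  move=> hp; exists 0, p'; split=> // A v.
  by split=> [h|[w]]; [exists (@vempty A)|]; rewrite vapp0.
elim: n / p => //.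
- by move=> n _; apply: (qf n FTop).
- by move=> n _; apply: (qf n FBot).
- by move=> n t u _; apply: (qf n (FEq t u)).
- by move=> n s args _; apply: (qf n (FRel args)).
- move=> n p IHp q IHq /andP[/IHp[k1 [p1 [hp1 e1]]] /IHq[k2 [p2 [hp2 e2]]]].
  (* The two blocks are placed side by side and the free variables are shared. *)
  pose r1 := vapp (lshift n \o lshift k2) (@rshift (k1 + k2) n) : 'I_(k1 + n) -> _.
  pose r2 := vapp (lshift n \o @rshift k1 k2) (@rshift (k1 + k2) n) : 'I_(k2 + n) -> _.
  exists (k1 + k2), (FAnd (fren p1 r1) (fren p2 r2)); split.
    move: (qf_positive_fren p1 r1) (qf_positive_fren p2 r2).
    rewrite hp1 hp2 /qf_positive /= => /andP[-> ->] /andP[-> ->]; exact: isT.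
  move=> A v; rewrite /= e1 e2; split.
    move=> [[w1 h1] [w2 h2]]; exists (vapp w1 w2).
    by rewrite !sat_fren !comp_vapp !compA !vapp_lshift !vapp_rshift.
  move=> [w]; rewrite !sat_fren !comp_vapp !compA !vapp_lshift !vapp_rshift.
  by move=> [h1 h2]; split; eexists; eassumption.
- move=> n p IHp q IHq /andP[/IHp[k1 [p1 [hp1 e1]]] /IHq[k2 [p2 [hp2 e2]]]].
  pose r1 := vapp (lshift n \o lshift k2) (@rshift (k1 + k2) n) : 'I_(k1 + n) -> _.
  pose r2 := vapp (lshift n \o @rshift k1 k2) (@rshift (k1 + k2) n) : 'I_(k2 + n) -> _.
  exists (k1 + k2), (FOr (fren p1 r1) (fren p2 r2)); split.
    move: (qf_positive_fren p1 r1) (qf_positive_fren p2 r2).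
    rewrite hp1 hp2 /qf_positive /= => /andP[-> ->] /andP[-> ->]; exact: isT.
  (* The element [x] fills the block of the other disjunct; it exists since structures are
     inhabited. *)
  move=> A v; rewrite /= e1 e2; have [x] := carrier_inhabited A; split.
    move=> [[w h]|[w h]].
      exists (vapp w (fun=> x)); left.
      by rewrite !sat_fren !comp_vapp !compA !vapp_lshift !vapp_rshift.
    exists (vapp (fun=> x) w); right.
    by rewrite !sat_fren !comp_vapp !compA !vapp_lshift !vapp_rshift.
  move=> [w]; rewrite !sat_fren !comp_vapp !compA !vapp_lshift !vapp_rshift.
  by move=> [h|h]; [left|right]; eexists; eassumption.
- move=> n p IHp /IHp[k [q [hq e]]].
  (* The variable bound by [FEx] becomes the head of the enlarged block. *)
  pose r := vapp (lshift n \o lift ord0) (vcons (lshift n ord0) (@rshift k.+1 n)).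
  exists k.+1, (fren q r); split; first by rewrite qf_positive_fren.
  have E (A : Type) (w : 'I_k.+1 -> A) (v : 'I_n -> A) :
      vapp w v \o r = vapp (w \o lift ord0) (vcons (w ord0) v).
    have /(congr1 (@^~ ord0)) /= h := vapp_lshift w v.
    by rewrite comp_vapp comp_vcons !compA vapp_lshift vapp_rshift h.
  move=> A v; split=> [[x /e[w h]]|[w]].
    by exists (vcons x w); rewrite sat_fren E vcons0 vcons_lift.
  by rewrite sat_fren E => h; exists (w ord0); apply/e; exists (w \o lift ord0).
Qed.
End Syntax.

(** Choice with a default value: in an ultraproduct witnesses exist only at almost every index, yet
    an element of the product needs a value at each one. *)
Lemma ex_witnesses (I : Type) (B : I -> Type) (P : forall i, B i -> Prop) :
  (forall i, inhabited (B i)) ->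
  exists x : forall i, B i, forall i, (exists y, P i y) -> P i (x i).
Proof.
move=> hB; have w i : exists x, (exists y, P i y) -> P i x.
  have [x0] := hB i; have [[x hx]|h] := pselect (exists y, P i y); first by exists x.
  by exists x0 => /h.
by exists (fun i => projT1 (cid (w i))) => i; case: cid.
Qed.

(** * Ultraproducts *)

Section Ultraproduct.
Variables (L : language) (I : Type) (B : I -> structure L) (U : set (set I)).
Hypothesis UU : UltraFilter U.

#[local] Instance ultra_filter : ProperFilter U := ultra_proper.

Lemma ultra_not (S : set I) : U (~` S) <-> ~ U S.
Proof.
split=> [hC hS|hS]; last by case: (in_ultra_setVsetC S UU).
by have [i []] := filter_ex (filterI hC hS).
Qed.

(** The quotient of the product by equality [U]-almost everywhere, realized as the type of
    equivalence classes. *)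
Definition ucarrier : Type :=
  {S : set (forall i, B i) | exists x, S = [set y | U [set i | x i = y i]]}.

Definition uproj (x : forall i, B i) : ucarrier :=
  exist _ [set y | U [set i | x i = y i]] (ex_intro _ x erefl).

Definition urep (c : ucarrier) : forall i, B i := projT1 (cid (svalP c)).

Lemma uprojP (x y : forall i, B i) : uproj x = uproj y <-> U [set i | x i = y i].
Proof.
split=> [[E]|h].
  have : [set z | U [set i | y i = z i]] y by apply: filterE.
  by rewrite -E.
rewrite /uproj; apply: eq_exist; apply/seteqP; split=> z /=; apply: filterS2 h => i /= -> //.
Qed.

Lemma urepK (c : ucarrier) : uproj (urep c) = c.
Proof.
rewrite /urep; case: cid => x; case: c => S hS /= E; rewrite /uproj.
by apply: eq_exist.
Qed.

Lemma urep_uproj (x : forall i, B i) : U [set i | urep (uproj x) i = x i].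
Proof. by apply/uprojP; rewrite urepK. Qed.

Lemma ucarrier_inhabited : inhabited ucarrier.
Proof.
have [x _] := ex_witnesses (fun i (_ : B i) => True) (fun i => carrier_inhabited (B i)).
exact: (inhabits (uproj x)).
Qed.

Definition ultraproduct : structure L :=
  @Structure L ucarrier ucarrier_inhabited
    (fun f args => uproj (fun i => finterp (fun j => urep (args j) i)))
    (fun r args => U [set i | rinterp (fun j => urep (args j) i)]).

Lemma eval_uproj n (t : term L n) (v : 'I_n -> forall i, B i) :
  eval (A := ultraproduct) (fun j => uproj (v j)) t = uproj (fun i => eval (v^~ i) t).
Proof.
elim: t => //= f args IH; apply/uprojP.
(* Arities are finite, so the large sets on which the chosen representatives are correct intersect
   in a large set. *)
have : U [set i | forall j, urep (uproj (fun i => eval (v^~ i) (args j))) i =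
                            eval (v^~ i) (args j)].
  by apply: filter_forall => j; apply: urep_uproj.
apply: filterS => i /= h; congr finterp; apply/funext => j.
by rewrite IH h.
Qed.

(** Disjunction and implication use that [U] decides every set; the quantifiers use witnesses, or
    counterexamples, chosen index by index. *)
Theorem Los n (p : formula L n) (v : 'I_n -> forall i, B i) :
  sat (A := ultraproduct) p (fun j => uproj (v j)) <-> U [set i | sat p (v^~ i)].
Proof.
have vconsE m (x : forall i, B i) (w : 'I_m -> forall i, B i) :
    vcons (uproj x) (fun j => uproj (w j)) = (fun j => uproj (vcons x w j)).
  by rewrite -[LHS]/(vcons _ (uproj \o w)) -comp_vcons.
have vcons_at m (x : forall i, B i) (w : 'I_m -> forall i, B i) i :
    (vcons x w)^~ i = vcons (x i) (w^~ i).
  by rewrite -[RHS](comp_vcons (fun z : forall i, B i => z i)).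
elim: n / p v => /=.
- by move=> n v; split=> // _; apply: filterE.
- by move=> n v; split=> // /filter_ex[].
- by move=> n t u v; rewrite !eval_uproj uprojP.
- move=> n r args v.
  have h : U [set i | forall j, urep (eval (A := ultraproduct) (fun j => uproj (v j)) (args j)) i =
                            eval (v^~ i) (args j)].
    by apply: filter_forall => j; rewrite eval_uproj; apply: urep_uproj.
  split=> h'; apply: filterS2 h h' => i /= h.
    by under eq_fun do rewrite h.
  by under [in X in _ -> X]eq_fun do rewrite h.
- move=> n p IHp q IHq v; rewrite IHp IHq; split=> [[]|h]; first exact: filterI.
  by split; apply: filterS h => i [].
- move=> n p IHp q IHq v; rewrite IHp IHq; split=> [[]|h].
  + by apply: filterS => i; left.
  + by apply: filterS => i; right.
  apply: contrapT => /not_orP[/ultra_not hp /ultra_not hq].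
  by have [i [[hi|hi] [hpi hqi]]] := filter_ex (filterI h (filterI hp hq)); [apply: hpi|apply: hqi].
- move=> n p IHp q IHq v; rewrite IHp IHq; split=> [h|h hp].
    have [/h|/ultra_not] := pselect (U [set i | sat p (v^~ i)]).
      by apply: filterS => i hq _.
    by apply: filterS => i hp /hp.
  by apply: filterS2 hp h => i hp; apply.
- move=> n p IH v; split=> [[x]|h].
    rewrite -(urepK x) vconsE IH; apply: filterS => i /=.
    by rewrite vcons_at; exists (urep x i).
  have [x hx] :=
    ex_witnesses (fun i x => sat p (vcons x (v^~ i))) (fun i => carrier_inhabited (B i)).
  exists (uproj x); rewrite vconsE IH; apply: filterS h => i /= /hx.
  by rewrite vcons_at.
- move=> n p IH v; split=> [h|h x]; last first.
    by rewrite -(urepK x) vconsE IH; apply: filterS h => i /= h; rewrite vcons_at.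
  apply: contrapT => /ultra_not hn.
  have [x hx] :=
    ex_witnesses (fun i x => ~ sat p (vcons x (v^~ i))) (fun i => carrier_inhabited (B i)).
  move: (h (uproj x)); rewrite vconsE IH => hU.
  have [i [/= hi]] := filter_ex (filterI hn hU).
  rewrite vcons_at; apply: hx.
  by apply: contrapT => /forallNP h'; apply: hi => y; apply: contrapT; apply: h'.
Qed.

Lemma ultraproduct_holds (s : sentence L) :
  (forall i, holds (B i) s) -> holds ultraproduct s.
Proof.
move=> h; have E : @vempty ultraproduct = fun j => uproj (@vempty (forall i, B i) j).
  by rewrite [RHS]vempty_eq.
rewrite /holds E Los; apply: filterE => i.
by rewrite /= [X in sat s X]vempty_eq; apply: h.
Qed.

End Ultraproduct.

(** * Continuation into a positively closed model *)

Lemma homomorphism_positive L (A B : structure L) (f : A -> B) :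
  homomorphism f ->
  forall n (p : formula L n), positive p ->
  forall a : 'I_n -> A, sat p a -> sat p (f \o a).
Proof.
move=> hf n p; elim: n / p => //.
- by move=> n t u _ a; apply: hf.
- by move=> n r args _ a; apply: hf.
- by move=> n p IHp q IHq /= /andP[hp hq] a [/IHp h /IHq h']; split; auto.
- by move=> n p IHp q IHq /= /andP[hp hq] a [/IHp h|/IHq h]; [left|right]; auto.
- by move=> n p IH /= hp a [x /(IH hp)]; rewrite comp_vcons; exists (f x).
Qed.

(** Preservation carries the premise of an h-inductive sentence into [B], and reflection brings its
    conclusion back to [A]. *)
Lemma immersion_holds L (A B : structure L) (f : A -> B) (s : sentence L) :
  immersion f -> h_inductive s -> holds B s -> holds A s.
Proof.
move=> hf; elim=> [n k l psi phi /andP[_ hpsi] /andP[_ hphi]|s1 s2 _ IH1 _ IH2].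
  rewrite !holds_all_closure => h v /= hv.
  apply/(hf _ _ (positive_ex_block hphi)); apply: h.
  exact/(hf _ _ (positive_ex_block hpsi)).
by move=> [/IH1 h1 /IH2 h2].
Qed.

(** * Substructures given by a positive Tarski-Vaught test *)

Section Substructure.
Variables (L : language) (B : structure L) (S : set B).
Hypothesis S0 : exists x, S x.
(* The Tarski-Vaught condition, for positive formulas only. *)
Hypothesis TV : forall n (p : formula L n.+1) (v : 'I_n -> B),
  positive p -> (forall i, S (v i)) -> (exists y, sat p (vcons y v)) ->
  exists y, S y /\ sat p (vcons y v).

(** The equation [y = f(x)] is a positive formula whose only witness [y] is the value of [f]. *)
Lemma substructure_closed (f : Defs.fsym L) (args : 'I_(farity f) -> {x : B | S x}) :
  S (finterp (fun i => sval (args i))).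
Proof.
pose p := FEq (Var L ord0) (@App L _ f (fun i : 'I_(farity f) => Var L (lift ord0 i))).
have E y (v : 'I_(farity f) -> B) : sat p (vcons y v) <-> y = finterp v.
  by rewrite /= vcons0 -[fun i => _]/(vcons y v \o lift ord0) vcons_lift.
have [|| y [hy /E <-//]] := @TV _ p (fun i => sval (args i)) isT.
  by move=> i; apply: svalP.
by eexists; apply/E.
Qed.

Definition substructure : structure L :=
  @Structure L {x : B | S x}
    (let: ex_intro x hx := S0 in inhabits (exist _ x hx))
    (fun f args => exist _ _ (substructure_closed args))
    (fun r args => rinterp (fun i => sval (args i))).

Definition substructure_val (x : substructure) : B := sval x.

Lemma substructure_val_inj : injective substructure_val.
Proof. by move=> [x hx] [y hy] /= E; apply: eq_exist. Qed.

Lemma substructure_immersion : immersion substructure_val.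
Proof.
have hev n (t : term L n) (v : 'I_n -> substructure) :
    substructure_val (eval v t) = eval (substructure_val \o v) t.
  by elim: t => //= f args IH; congr finterp; apply/funext => i; apply: IH.
move=> n p; elim: n / p => //=.
- by move=> n t u _ a; rewrite -!hev; split=> [->|/substructure_val_inj].
- move=> n r args _ a.
  suff -> : (fun i => eval (substructure_val \o a) (args i)) =
            (fun i => substructure_val (eval (A := substructure) a (args i))) by [].
  by apply/funext => i; rewrite hev.
- by move=> n p IHp q IHq /andP[/IHp hp /IHq hq] a; rewrite hp hq.
- by move=> n p IHp q IHq /andP[/IHp hp /IHq hq] a; rewrite hp hq.
- move=> n p IH hp a; split=> [[x /(IH hp)]|].
    by rewrite comp_vcons; exists (substructure_val x).
  move=> /(TV hp)[i|y [hy h]]; first exact: svalP.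
  by exists (exist _ y hy); apply/(IH hp); rewrite comp_vcons.
Qed.

End Substructure.

(** * Henkin constants and maximal positive diagrams *)

Section Continuation.
Variables (L : language) (T : set (sentence L)) (A : structure L).
Hypothesis hT : h_inductive_theory T.

(** [hwit p d] stands for a witness of [p] over the earlier constants [d]. The constants do not
    depend on any interpretation, so diagrams of different models are subsets of one type. *)
Inductive hconst : Type :=
| hbase (a : A)
| hwit n (p : formula L n.+1) (d : 'I_n -> hconst).

Section Named.
Variables (B : structure L) (g : hconst -> B).

(* An interpretation of the constants may take arbitrary values on constants
   whose existential formula fails; [named] singles out the meaningful ones. *)
Fixpoint named (x : hconst) : Prop :=
  match x with
  | hbase _ => True
  | hwit n p d => [/\ positive p, forall i, named (d i)
                    & exists y, sat p (vcons y (g \o d))]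
  end.

Definition henkin : Prop := forall n (p : formula L n.+1) (d : 'I_n -> hconst),
  named (hwit p d) -> sat p (vcons (g (hwit p d)) (g \o d)).

(** Restricting to named constants allows the values of the others to be changed without losing
    facts. *)
Definition posdiag : set {n & (formula L n * ('I_n -> hconst))%type} :=
  fun t => [/\ positive (tagged t).1, forall i, named ((tagged t).2 i)
             & sat (tagged t).1 (g \o (tagged t).2)].

End Named.

(** Zorn's lemma is applied to these diagrams, ordered by inclusion in a fixed type, rather than to
    the pairs of a model and an interpretation. *)
Definition admissible (D : set {n & (formula L n * ('I_n -> hconst))%type}) : Prop :=
  exists (B : structure L) (g : hconst -> B),
    [/\ model T B, homomorphism (g \o hbase), henkin g & D = posdiag g].

Lemma posdiagE (B : structure L) (g : hconst -> B) n (p : formula L n) (d : 'I_n -> hconst) :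
  posdiag g (Tagged _ (p, d)) =
  [/\ positive p, forall i, named g (d i) & sat p (g \o d)].
Proof. by []. Qed.

(** The trivial formula in one variable records in the diagram that a constant is named, so an
    inclusion of diagrams transports [named]. *)
Lemma posdiag_named (B : structure L) (g : hconst -> B) (x : hconst) :
  posdiag g (Tagged _ (@FTop L 1, fun=> x)) <-> named g x.
Proof. by rewrite posdiagE; split=> [[_ /(_ ord0)]|]. Qed.

(** Witnesses are chosen by recursion on constants, since whether [hwit p d] needs one depends on
    the new values of [d]. *)
Lemma henkin_redefine (N : structure L) (P : set hconst) (h : hconst -> N) :
  exists g : hconst -> N,
    (forall x, P x -> g x = h x) /\
    (forall n (p : formula L n.+1) (d : 'I_n -> hconst), ~ P (hwit p d) ->
      named g (hwit p d) -> sat p (vcons (g (hwit p d)) (g \o d))).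
Proof.
pose g := fix g x := if pselect (P x) then h x else
  match x with
  | hbase _ => h x
  | hwit n p d => if pselect (exists y, sat p (vcons y (fun i => g (d i)))) is left e
                  then projT1 (cid e) else h x
  end.
exists g; split=> [x|n p d]; first by case: x => [a|n p d] /=; case: pselect.
move=> nP [_ _ e] /=; case: (pselect (P _)) => //= _.
by case: pselect => // e'; case: cid.
Qed.

(** Constants named under [g] keep their value under [h]: their witness property belongs to
    [posdiag g], hence holds in [N]. The other constants are redefined, as they may become named in
    [N]. *)
Lemma henkin_transfer (B N : structure L) (g : hconst -> B) (h : hconst -> N) :
  henkin g ->
  (forall n (p : formula L n) (d : 'I_n -> hconst),
    posdiag g (Tagged _ (p, d)) -> sat p (h \o d)) ->
  exists g' : hconst -> N,
    [/\ henkin g', posdiag g `<=` posdiag g'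
      & forall x, named g x -> g' x = h x].
Proof.
move=> hg hh; have [g' [g'h g'w]] := henkin_redefine (named g) h; exists g'.
have eqd n (d : 'I_n -> hconst) : (forall i, named g (d i)) -> g' \o d = h \o d.
  by move=> hd; apply/funext => i; apply: g'h.
have wit n (p : formula L n.+1) d : named g (hwit p d) ->
    sat p (vcons (g' (hwit p d)) (g' \o d)).
  move=> hw; have [hp hd _] := hw; rewrite (eqd _ _ hd) g'h // -comp_vcons.
  apply: hh; split=> //= [i|]; last by rewrite comp_vcons; apply: hg.
  by rewrite /vcons; case: unlift.
have sub x : named g x -> named g' x.
  elim: x => // n p d IH hw; have [hp hd _] := hw; split=> //.
    by move=> i; apply: IH; apply: hd.
  by eexists; apply: wit.
split=> //.
  move=> n p d hw; have [/wit //|hn] := pselect (named g (hwit p d)).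
  exact: g'w.
move=> [n [p d]] hpd; have [hp hd _] := hpd; split=> //= [i|]; first exact: sub.
by rewrite eqd //; apply: hh.
Qed.

Lemma admissible_start : model T A -> exists D, admissible D.
Proof.
move=> hA; have [a0] := carrier_inhabited A.
have [g [g1 g2]] := henkin_redefine [set x | exists a, x = hbase a]
   (fun x => if x is hbase a then a else a0).
exists (posdiag g), A, g; split=> //.
  have -> : g \o hbase = id by apply/funext => a /=; rewrite g1 //; exists a.
  by [].
by move=> n p d; apply: g2 => -[].
Qed.

(** An ultraproduct of models along an ultrafilter containing all tails of the chain realizes the
    union. *)
Lemma chain_upper_bound (F : set (set {n & (formula L n * ('I_n -> hconst))%type})) :
  F `<=` admissible -> F !=set0 -> total_on F subset ->
  admissible (\bigcup_(D in F) D).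
Proof.
move=> hF [D0 FD0] Ftot; pose I := {D | F D}.
have /choice [B] : forall i : I, exists B : structure L, exists g : hconst -> B,
  [/\ model T B, homomorphism (g \o hbase), henkin g & sval i = posdiag g].
  by move=> i; apply: hF; apply: svalP.
move=> /(_ _)/cid - gP.
pose g i := projT1 (gP i).
have Bmodel i : model T (B i) by rewrite /g; case: (projT2 (gP i)).
have ghom i : homomorphism (g i \o hbase) by rewrite /g; case: (projT2 (gP i)).
have ghen i : henkin (g i) by rewrite /g; case: (projT2 (gP i)).
have gE i : sval i = posdiag (g i) by rewrite /g; case: (projT2 (gP i)).
have tails : ProperFilter (filter_from setT
    (fun i : I => [set j : I | sval i `<=` sval j])).
  apply: filter_from_proper; last by move=> i _; exists i => /=.
  apply: filter_from_filter; first by exists (exist _ D0 FD0).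
  move=> i j _ _; have [ij|ji] := Ftot _ _ (svalP i) (svalP j).
    by exists j => // k jk; split=> //=; apply: subset_trans jk.
  by exists i => // k ik; split=> //=; apply: subset_trans ik.
have [U [UU sU]] := ultraFilterLemma tails.
have UF := @ultra_filter _ _ UU.
pose gs (x : hconst) : ultraproduct B U := uproj U (fun i => g i x).
have los n (p : formula L n) (d : 'I_n -> hconst) :
    sat p (gs \o d) <-> U [set i | sat p (g i \o d)].
  by rewrite -(@Los _ _ _ _ UU _ p (fun j i => g i (d j))).
have losw n (p : formula L n.+1) (d : 'I_n -> hconst) :
    (exists y, sat p (vcons y (gs \o d))) <->
    U [set i | exists y, sat p (vcons y (g i \o d))] := los _ (FEx p) d.
have namedE x : named gs x <-> U [set i | named (g i) x].
  elim: x => [a|n p d IH]; first by split=> // _; apply: filterE.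
  split=> [[hp hd /losw he]|h].
    have hd' : U [set i | forall j, named (g i) (d j)].
      by apply: filter_forall => j; apply/IH; apply: hd.
    by apply: filterS2 hd' he => i.
  split.
  - by have [i []] := filter_ex h.
  - by move=> j; apply/IH; apply: filterS h => i [_ hd _]; apply: hd.
  - by apply/losw; apply: filterS h => i [].
have diagE t : posdiag gs t <-> U [set i | sval i t].
  under [X in U X]eq_set do rewrite gE.
  case: t => n [p d]; split=> [[hp hd /los hs]|h].
    have hd' : U [set i | forall j, named (g i) (d j)].
      by apply: filter_forall => j; apply/namedE; apply: hd.
    by apply: filterS2 hd' hs => i.
  split.
  - by have [i []] := filter_ex h.
  - by move=> j; apply/namedE; apply: filterS h => i [_ hd _]; apply: hd.
  - by apply/los; apply: filterS h => i [].
exists (ultraproduct B U), gs; split.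
- by move=> s Ts; apply: ultraproduct_holds => i; apply: Bmodel.
- move=> n p hp a ha; rewrite -compA; apply/los; apply: filterE => i.
  by rewrite compA; apply: ghom.
- move=> n p d /namedE h.
  rewrite -comp_vcons; apply/los; apply: filterS h => i h.
  by rewrite /= comp_vcons; apply: ghen.
(* A fact of [D] persists on the tail above [D], which is large; conversely a large set of indices
   is nonempty. *)
apply/seteqP; split=> t.
  move=> [D FD Dt]; apply/diagE; apply: sU.
  by exists (exist _ D FD) => // j /= /(_ _ Dt).
by move=> /diagE/filter_ex[i it]; exists (sval i) => //; apply: svalP.
Qed.

Theorem pc_continuation : model T A ->
  exists (C : structure L) (f : A -> C), pc_model T C /\ homomorphism f.
Proof.
move=> hA.
have [D [Dadm Dmax]] : exists D, admissible D /\
    forall D', D `<=` D' -> admissible D' -> D' `<=` D.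
  (* The empty diagram is added because [Zorn_bigcup] also asks for the union of the empty chain. *)
  have [F Fadm Ftot|D [hD Dmax]] :=
      @Zorn_bigcup _ [set D | D = set0 \/ admissible D].
    have [/eqP F0|] := pselect (\bigcup_(X in F) X = set0); first by left; apply/eqP.
    move=> hne; right.
    have -> : \bigcup_(X in F) X = \bigcup_(X in F `&` admissible) X.
      apply/seteqP; split=> t [X].
        by move=> FX Xt; exists X => //; split=> //; case: (Fadm _ FX) Xt => [->|].
      by move=> [FX _] Xt; exists X.
    apply: chain_upper_bound; first by move=> X [].
      apply: contrapT => h; apply: hne; apply/seteqP; split=> // t [X FX Xt].
      by case: (Fadm _ FX) Xt => [->|Xa] // _; apply: h; exists X.
    by move=> X Y [FX _] [FY _]; apply: Ftot.
  have max D' : D `<=` D' -> admissible D' -> D' `<=` D.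
    move=> DD' D'a; apply: contrapT => nD'D.
    by apply: (Dmax D'); [split|right].
  (* If the maximal diagram is empty, it contains the diagram supplied by [admissible_start], hence
     equals it and is admissible. *)
  exists D; split=> //; case: hD => // D0.
  have [D' D'a] := admissible_start hA.
  suff <- : D' = D by [].
  by apply/seteqP; split; [apply: max => //|]; rewrite D0.
case: Dadm => B [g [hB ghom ghen DE]]; rewrite {}DE in Dmax.
(* The values of named constants pass the Tarski-Vaught test, since a solvable positive formula over
   them names a further constant. *)
pose S : set B := [set y | exists2 x, named g x & g x = y].
have pull n (v : 'I_n -> B) : (forall i, S (v i)) ->
    exists2 d, forall i, named g (d i) & v = g \o d.
  move=> hv; have /choice[d hd] : forall i, exists x, named g x /\ g x = v i.
    by move=> i; have [x] := hv i; exists x.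
  by exists d => [i|]; [case: (hd i)|apply/funext => i; case: (hd i)].
have S0 : exists y, S y.
  by have [a] := carrier_inhabited A; exists (g (hbase a)), (hbase a).
have TV n (p : formula L n.+1) (v : 'I_n -> B) :
    positive p -> (forall i, S (v i)) -> (exists y, sat p (vcons y v)) ->
    exists y, S y /\ sat p (vcons y v).
  move=> hp /pull[d hd ->] e; have hw : named g (hwit p d) by split.
  by exists (g (hwit p d)); split; [exists (hwit p d)|apply: ghen].
pose C := substructure S0 TV; pose val := @substructure_val _ _ _ S0 TV.
have himm : immersion val := @substructure_immersion _ _ _ S0 TV.
have [c hc] : exists c : hconst -> C, forall x, named g x -> val (c x) = g x.
  have /choice[c hc] : forall x, exists y : C, named g x -> val y = g x.
    move=> x; have [hx|hx] := pselect (named g x).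
      have Sx : S (g x) by exists x.
      by exists (exist _ _ Sx).
    by have [y] := carrier_inhabited C; exists y.
  by exists c.
have diagC n (p : formula L n) (d : 'I_n -> hconst) :
    posdiag g (Tagged _ (p, d)) -> sat p (c \o d).
  move=> [/= hp hd hs]; apply/(himm _ _ hp).
  by have <- : g \o d = val \o (c \o d) by apply/funext => i; rewrite /= hc.
exists C, (c \o hbase); split; first split.
- by move=> s Ts; apply: (immersion_holds himm); [apply: hT|apply: hB].
(* Reflection: transferring the constants along [f] gives an admissible diagram extending that of
   [g]. By maximality a positive fact true in [N] about the image of [v] already lies in the latter,
   hence holds in [C]. *)
- move=> N f hN hf n p hp v; split=> [|hs]; first exact: homomorphism_positive.
  have [g' [g'hen sub g'E]] : exists g' : hconst -> N, [/\ henkin g',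
      posdiag g `<=` posdiag g' & forall x, named g x -> g' x = (f \o c) x].
    apply: henkin_transfer => // m q d hq; rewrite -compA.
    by apply: homomorphism_positive (diagC _ _ _ hq) => //; case: hq.
  have adm' : admissible (posdiag g').
    exists N, g'; split=> // m q hq a ha.
    have hqp : positive q by case: (q) hq.
    rewrite -compA; have : posdiag g' (Tagged _ (q, hbase \o a)); last by case.
    by apply: sub; split=> //=; rewrite compA; apply: ghom.
  have [d hd vE] : exists2 d, forall i, named g (d i) & v = c \o d.
    have [i|d hd vE] := @pull _ (val \o v); first exact: svalP.
    exists d => //; apply/funext => i.
    by apply: substructure_val_inj; rewrite -/val -[LHS]/((val \o v) i) vE; apply/esym/hc.
  rewrite vE; apply: diagC; apply: (Dmax _ sub adm'); split=> //= [i|].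
    by apply/posdiag_named; apply: sub; apply/posdiag_named.
  have -> // : g' \o d = f \o v by rewrite vE; apply/funext => i; rewrite /= g'E.
- move=> n p hp a ha; rewrite -compA; apply: diagC.
  have hpp : positive p by case: (p) hp.
  by split=> //=; rewrite compA; apply: ghom.
Qed.

End Continuation.

(** * Quantifier-free types and separation *)

Lemma atomic_positive L n (p : formula L n) : atomic p -> positive p.
Proof. by case: p. Qed.

(** The conjunction of the equalities true in [u]; a tuple [w] satisfying it is the image of [u]
    under a map. *)
Lemma equality_type L (A : structure L) N (u : 'I_N -> A) :
  exists q : formula L N, [/\ positive q, sat q u &
    forall w : 'I_N -> A, sat q w -> forall i j, u i = u j -> w i = w j].
Proof.
have [|q [hq qE]] := @finite_conj L N ('I_N * 'I_N)%type
  (fun ij => if pselect (u ij.1 = u ij.2) then FEq (Var L ij.1) (Var L ij.2) else FTop).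
  by move=> ij; case: pselect.
exists q; split=> //; first by apply/qE => ij; case: pselect.
by move=> w /qE h i j uij; move: (h (i, j)) => /=; case: pselect.
Qed.

(** The ultrapower is indexed by all maps [h : A -> A], and [x] is sent to the class of its values
    [h x]. Almost every [h] takes [b] to [a], so [p] holds at the image of [b], and the immersion
    reflects it. *)
Lemma pc_tp_maximal L (T : set (sentence L)) (A : structure L) n (a b : 'I_n -> A) :
  pc_model T A -> tp b `<=` tp a -> tp a `<=` tp b.
Proof.
move=> [hA pcA] hba p [hp pa]; split=> //.
pose Idx := {m & (formula L m * ('I_m -> A))%type}.
pose mk m (q : formula L m) (c : 'I_m -> A) : Idx :=
  Tagged (fun m => (formula L m * ('I_m -> A))%type) (q, c).
pose D : set Idx := [set t | positive (tagged t).1 /\ sat (tagged t).1 (tagged t).2].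
pose S (t : Idx) : set (A -> A) :=
  [set h : A -> A | sat (tagged t).1 (h \o (tagged t).2) /\ h \o b = a].
(* Finitely many facts about c are realized together with b |-> a: tp b is
   included in tp a, and the formula e makes the realization a function of c, b. *)
have FS : ProperFilter (filter_from D S).
  apply: filter_from_proper.
    apply: filter_from_filter; first by exists (mk 0 FTop (@vempty A)).
    move=> [m1 [p1 c1]] [m2 [p2 c2]] [/= hp1 s1] [/= hp2 s2].
    exists (mk (m1 + m2) (FAnd (fren p1 (lshift m2)) (fren p2 (@rshift m1 m2)))
                       (vapp c1 c2)).
      by split=> /=; rewrite ?positive_fren ?hp1 // !sat_fren vapp_lshift vapp_rshift.
    move=> h [/=]; rewrite !sat_fren comp_vapp vapp_lshift vapp_rshift => -[h1 h2] hb.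
    by split.
  move=> [m [q c]] [/= hq sq].
  have [e [he se eP]] := equality_type (vapp c b).
  have [] : tp a (ex_block (FAnd (fren q (lshift n)) e)).
    apply: hba; split.
      by apply: positive_ex_block; rewrite /= positive_fren hq.
    by apply/sat_ex_block; exists c; split=> //; rewrite sat_fren vapp_lshift.
  move=> _ /sat_ex_block[w [/= hw /eP ew]].
  have /choice[h hh] : forall x, exists y, forall i, vapp c b i = x -> vapp w a i = y.
    move=> x; have [[i <-]|hx] := pselect (exists i, vapp c b i = x).
      by exists (vapp w a i) => j; apply: ew.
    by exists x => i hi; case: hx; exists i.
  have hE : h \o vapp c b = vapp w a by apply/funext => i /=; rewrite -(hh _ i).
  exists h; split=> /=.
    by rewrite -(vapp_lshift c b) compA hE -sat_fren.
  by rewrite -[in LHS](vapp_rshift c b) compA hE vapp_rshift.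
have [U [UU sU]] := ultraFilterLemma FS.
have UF := @ultra_filter _ _ UU.
pose f (x : A) : ultraproduct (fun=> A) U := uproj U (fun h : A -> A => h x).
have los m (q : formula L m) (v : 'I_m -> A) :
    sat q (f \o v) <-> U [set h : A -> A | sat q (h \o v)].
  by rewrite -(@Los _ _ _ _ UU _ q (fun j h => h (v j))).
(* A single [h] may fail to be a homomorphism, but each atomic fact of [A] is preserved by almost
   every [h]. *)
have fhom : homomorphism f.
  move=> m q hq v hv; apply/los.
  have : U (S (mk m q v)).
    by apply/sU/in_filter_from; split=> //=; apply: atomic_positive.
  by apply: filterS => h [].
apply/(pcA _ f _ fhom _ _ hp).
  by move=> s Ts; apply: ultraproduct_holds => _; apply: hA.
apply/los; have : U (S (mk 0 FTop (@vempty A))).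
  by apply/sU/in_filter_from.
by apply: filterS => h [_ /= ->].
Qed.

(** The index set consists of the [n]-tuples of [A], so the classes of the coordinate functions form
    a generic solution of [phi] satisfying [tpqf a]. *)
Lemma lpR_separation L (T : set (sentence L)) (A : structure L) :
  h_inductive_theory T -> lpR T -> pc_model T A ->
  forall n (phi : formula L n), positive phi ->
  forall a : 'I_n -> A, ~ sat phi a ->
  exists psi : formula L n, [/\ qf_positive psi, sat psi a &
    forall b : 'I_n -> A, ~ (sat phi b /\ sat psi b)].
Proof.
move=> hT lpT pcA n phi hphi a hna; apply: contrapT => hno.
have [hA immA] := pcA.
pose S (psi : formula L n) : set ('I_n -> A) := [set b | sat phi b /\ sat psi b].
have FS : ProperFilter (filter_from (tpqf a) S).
  apply: filter_from_proper.
    apply: filter_from_filter; first by exists FTop.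
    move=> p q [hp pa] [hq qa]; exists (FAnd p q); last by move=> b [? []].
    split=> //; move: hp hq; rewrite /qf_positive /=.
    by move=> /andP[-> ->] /andP[-> ->].
  move=> psi [hpsi psia]; apply: contrapT => hS; apply: hno; exists psi.
  by split=> // b hb; apply: hS; exists b.
have [U [UU sU]] := ultraFilterLemma FS.
have UF := @ultra_filter _ _ UU.
pose M := ultraproduct (fun _ : 'I_n -> A => A) U.
pose e (x : A) : M := uproj U (fun=> x).
pose b (j : 'I_n) : M := uproj U (fun t => t j).
have los p : sat p b <-> U [set t | sat p t].
  by rewrite (@Los _ _ _ _ UU _ p (fun j t => t j)).
have ehom : homomorphism e.
  move=> m q hq v hv; apply/(@Los _ _ _ _ UU _ q (fun j _ => v j)).
  exact: filterE.
have hM : model T M by move=> s Ts; apply: ultraproduct_holds => _; apply: hA.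
have [C [f [pcC fhom]]] := pc_continuation hT hM.
have fehom : homomorphism (f \o e).
  by move=> m q hq v hv; rewrite -compA; apply: fhom => //; apply: ehom.
have feimm := immA _ _ (proj1 pcC) fehom.
(* Since [A] is pc, a formula true at the image of [a] in [C] is already true at [a], hence at
   almost every index. *)
have sub : tpqf ((f \o e) \o a) `<=` tpqf (f \o b).
  move=> q [hq qa]; split=> //; have /andP[_ hqp] := hq.
  apply: homomorphism_positive => //; apply/los.
  have : U (S q) by apply/sU/in_filter_from; split=> //; apply/(feimm _ _ hqp).
  by apply: filterS => t [].
apply/hna/(feimm _ _ hphi).
have : tp (f \o b) phi.
  split=> //; apply: homomorphism_positive => //; apply/los.
  have : U (S FTop) by apply/sU/in_filter_from.
  by apply: filterS => t [].
by rewrite -(lpT _ pcC _ _ _ sub) => -[].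
Qed.

(** * The theory of h-inductive sentences of [A] and the criterion *)

(** One direction holds because [A] is a model of [Tkstar A]; the other because the negation is
    equivalent to a member of [Tkstar A]. *)
Lemma Tkstar_entails_not_ex L (A : structure L) n (p : formula L n) : positive p ->
  entails (Tkstar A) (FNot (ex_closure p)) <-> forall v : 'I_n -> A, ~ sat p v.
Proof.
move=> hp; split=> [h v hv|h C hC].
  by apply: (h A); [move=> s [] | apply/holds_ex_closure; exists v].
move=> /holds_ex_closure[v hv].
have [k [q [hq qE]]] := positive_prenex hp.
(* The empty disjunction [FBot] under an empty block serves as the conclusion of the h-inductive
   sentence. *)
pose s : sentence L := all_closure (FImp (ex_block q) (@ex_block L 0 n FBot)).
have /hC : Tkstar A s.
  split; first exact: h_inductive_basic.
  by apply/holds_all_closure => w /= /sat_ex_block/qE /h.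
by move=> /holds_all_closure/(_ v); apply; apply/sat_ex_block/qE.
Qed.

Theorem theorem3p1 (L : language) (T : set (sentence L))
    (hT : h_inductive_theory T) :
  lpR T <->
  forall A : structure L, pc_model T A ->
  forall (n : nat) (phi : formula L n), positive phi ->
  forall a : 'I_n -> A, ~ sat phi a ->
  exists psi : formula L n,
    [/\ qf_positive psi, sat psi a
      & entails (Tkstar A) (FNot (ex_closure (FAnd phi psi)))].
Proof.
have posand n (phi psi : formula L n) :
    positive phi -> qf_positive psi -> positive (FAnd phi psi).
  by move=> /= -> /andP[].
split=> [lpT A pcA n phi hphi a hna|h A pcA n a b hab].
  have [psi [hpsi psia hno]] := lpR_separation hT lpT pcA hphi hna.
  by exists psi; split=> //; apply/Tkstar_entails_not_ex; [apply: posand|].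
(* A formula true at [b] and false at [a] would be separated by some [psi] in [tpqf a], which also
   holds at [b]. *)
have hba : tp b `<=` tp a.
  move=> phi [hphi phib]; split=> //; apply: contrapT => hna.
  have [psi [hpsi psia]] := h _ pcA _ _ hphi _ hna.
  move=> /(Tkstar_entails_not_ex _ (posand _ _ _ hphi hpsi))/(_ b); apply.
  by split=> //; have [] := hab psi.
by apply/seteqP; split=> //; apply: (pc_tp_maximal pcA).
Qed.
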